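(* Let $X$ be a real reflexive smooth Banach space and let $F \subset X$ be a convex existence set such that $F = \mathrm{cl}\left(\bigcup_{t \in T} F_t\right)$, where $\{F_t\}_{t \in T}$ is a family of convex compact existence sets totally ordered by inclusion. Then $F$ is a contractive set. Moreover, if $F$ is a convex compact existence set in a real smooth Banach space $X$ (not necessarily reflexive), then $F$ is a contractive set.
   Context: $X$ is smooth if every $x$ with $\|x\|=1$ admits exactly one $f \in X^*$ with $\|f\|=1$ and $f(x) = 1$. For a non-empty set $F \subset X$ and $x \in X$, let $R_F(x) = \{ d \in F : \|d-c\| \le \|x-c\| \text{ for all } c \in F\}$; $F$ is an existence set if $R_F(x) \neq \emptyset$ for every $x \in X$. A non-empty set $D \subset X$ is contractive if there exists $P : X \to D$ with $P|_D = \mathrm{id}_D$ and $\|Px - Py\| \le \|x-y\|$ for all $x,y \in X$. $\mathrm{cl}$ denotes norm closure. *)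

(* Defs.v *)
From HB Require Import structures.
From mathcomp Require Import all_boot all_order all_algebra.
From mathcomp Require Import all_classical all_reals all_analysis.
Set Implicit Arguments. Unset Strict Implicit. Unset Printing Implicit Defensive.
Import Order.TTheory GRing.Theory Num.Theory.
Import numFieldNormedType.Exports.
Local Open Scope classical_set_scope.
Local Open Scope ring_scope.

Section Defs.
Variables (R : realType) (X : normedModType R).

Definition is_dual (f : X -> R) : Prop :=
  (forall x y, f (x + y) = f x + f y) /\
  (forall (a : R) x, f (a *: x) = a * f x) /\
  continuous f.

Definition opnorm (f : X -> R) : R :=
  sup [set `|f x| | x in [set x : X | `|x| <= 1]].

Definition smooth_space : Prop :=
  forall x : X, `|x| = 1 ->
    exists! f : X -> R, is_dual f /\ opnorm f = 1 /\ f x = 1.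

(* X is reflexive: the canonical embedding X -> X^** is onto, i.e. every
   continuous (= bounded) linear functional phi on X^* (normed by opnorm)
   is evaluation at some x in X. *)
Definition reflexive_space : Prop :=
  forall phi : (X -> R) -> R,
    (forall f g, is_dual f -> is_dual g -> phi (f \+ g) = phi f + phi g) ->
    (forall (a : R) f, is_dual f -> phi (fun x => a * f x) = a * phi f) ->
    (exists C : R, forall f, is_dual f -> `|phi f| <= C * opnorm f) ->
    exists x : X, forall f, is_dual f -> phi f = f x.

Definition RF (F : set X) (x : X) : set X :=
  [set d | F d /\ forall c, F c -> `|d - c| <= `|x - c|].

Definition existence_set (F : set X) : Prop :=
  F !=set0 /\ forall x : X, RF F x !=set0.

Definition contractive (D : set X) : Prop :=
  D !=set0 /\
  exists P : X -> X, (forall x, D (P x)) /\ (forall d, D d -> P d = d) /\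
    (forall x y, `|P x - P y| <= `|x - y|).

End Defs.

(* Main.v *)
Require Import Defs.
From HB Require Import structures.
From mathcomp Require Import all_boot all_order all_algebra.
From mathcomp Require Import all_classical all_reals all_analysis.
From mathcomp Require Import ring lra.
Set Implicit Arguments. Unset Strict Implicit. Unset Printing Implicit Defensive.
Import Order.TTheory GRing.Theory Num.Theory.
Import numFieldNormedType.Exports.
Local Open Scope classical_set_scope.
Local Open Scope ring_scope.

(** Fix [x] and write [J(u)] for the derivative of [|.|^2 / 2] at [u], linear by
smoothness.  If [d] in [F] satisfies [J(d - c)(x - d) >= 0] for all [c] in [F],
then [x |-> d] is well defined, nonexpansive and fixes [F]: two such pairs
[(x, d)], [(y, e)] give [J(d - e)((x - y) - (d - e)) >= 0].

Such a [d] is found on a compact existence set as follows.  For a small step [s],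
iterate [d_(n+1)] in [R_F(d_n + s (x - d_n))]; telescoping [|d_n - c|^2] shows
that the average over [n] of [J(d_n - c)(x - d_n)] is almost nonnegative for
every [c] in [F].  Averaging over [c = d_m] as well and symmetrizing,
[J(u)(x - d_n) + J(-u)(x - d_m) = - |u|^2] for [u = d_n - d_m], so the [d_n]
concentrate around some [d_m], which is an approximate solution; a limit point
as [s -> 0] is an exact one.

In the reflexive case the retractions onto the members of the chain have a weak
limit along an ultrafilter, which is a retraction onto the closure of the union. *)

(** * Sublinear functionals and the Hahn-Banach theorem *)

Section HahnBanach.
Variables (R : realType) (V : lmodType R).
Implicit Types (p q : V -> R).

Definition sublinear p : Prop :=
  (forall x y, p (x + y) <= p x + p y) /\
  (forall (a : R) x, 0 < a -> p (a *: x) = a * p x).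

Lemma sublinear0 p : sublinear p -> p 0 = 0.
Proof. by case=> _ /(_ 2 0 ltac:(lra)); rewrite scaler0; lra. Qed.

Lemma sublinear_ge_opp p x : sublinear p -> - p (- x) <= p x.
Proof.
move=> sp; have [sD _] := sp.
by have := sD x (- x); rewrite subrr sublinear0//; lra.
Qed.

Definition inf_fun (I : Type) (h : I -> V -> R) (x : V) : R :=
  inf (range (h^~ x)).

Lemma inf_fun_le (I : Type) (h : I -> V -> R) (x : V) m i :
  (forall j, m <= h j x) -> inf_fun h x <= h i x.
Proof.
move=> hm; apply: ge_inf; last by exists i.
by exists m => _ [j _ <-]; exact: hm.
Qed.

Lemma inf_fun_ge (I : Type) (h : I -> V -> R) (x : V) m (i0 : I) :
  (forall j, m <= h j x) -> m <= inf_fun h x.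
Proof.
move=> hm; apply: lb_le_inf; first by exists (h i0 x), i0.
by move=> _ [j _ <-]; exact: hm.
Qed.

(** Subadditivity survives an infimum when any two indices admit a third one suited to the sum. This
    serves shifts, Zorn chains and difference quotients; [m] keeps [inf] away from its default
    value. *)
Lemma sublinear_inf (I : Type) (i0 : I) (h : I -> V -> R) (m : V -> R) :
  (forall i x, m x <= h i x) ->
  (forall i j x y, exists k, h k (x + y) <= h i x + h j y) ->
  (forall i (a : R) x, 0 < a -> exists k, h k (a *: x) <= a * h i x) ->
  sublinear (inf_fun h).
Proof.
move=> hm hD hZ.
have le i x : inf_fun h x <= h i x by apply: (@inf_fun_le _ _ _ (m x)) => j.
have leZ a x : 0 < a -> inf_fun h (a *: x) <= a * inf_fun h x.
  move=> a0; rewrite mulrC -ler_pdivrMr//; apply: (inf_fun_ge i0) => i.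
  rewrite ler_pdivrMr// mulrC.
  by have [k hk] := hZ i a x a0; exact: le_trans (le k _) hk.
split=> [x y|a x a0].
  rewrite -lerBlDr; apply: (inf_fun_ge i0) => i.
  rewrite lerBlDl -lerBlDr; apply: (inf_fun_ge i0) => j.
  rewrite lerBlDl; have [k hk] := hD i j x y.
  exact: le_trans (le k _) hk.
(* The reverse inequality is [leZ] for the factor [a^-1] at [a *: x]. *)
apply/eqP; rewrite eq_le leZ//= -ler_pdivlMl//.
by rewrite -{1}[x](scalerK (lt0r_neq0 a0)) leZ// invr_gt0.
Qed.

(* Lowers [q] to a sublinear functional whose value at [- w] is at most [- q w];
   a minimal sublinear [q] is thus odd, hence linear. *)
Definition shift_inf q (w : V) : V -> R :=
  inf_fun (fun (t : {t : R | 0 <= t}) v => q (v + sval t *: w) - sval t * q w).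

Lemma shift_inf_lb q w (t : {t : R | 0 <= t}) v : sublinear q ->
  - q (- v) <= q (v + sval t *: w) - sval t * q w.
Proof.
move=> sq; have [sD sZ] := sq; case: t => t /= t0.
have -> : t * q w = q (t *: w).
  move: t0; rewrite le_eqVlt => /orP[/eqP<-|/sZ->//].
  by rewrite mul0r scale0r sublinear0.
by have := sD (v + t *: w) (- v); rewrite [v + _]addrC addrK; lra.
Qed.

Lemma shift_inf_le q w v t : sublinear q -> 0 <= t ->
  shift_inf q w v <= q (v + t *: w) - t * q w.
Proof.
move=> sq t0.
pose h (t : {t : R | 0 <= t}) v := q (v + sval t *: w) - sval t * q w.
by apply: (@inf_fun_le _ h _ _ (exist _ t t0)) => j; exact: shift_inf_lb.
Qed.

Lemma sublinear_shift_inf q w : sublinear q -> sublinear (shift_inf q w).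
Proof.
move=> sq; have [sD sZ] := sq.
apply: (@sublinear_inf _ (exist _ 0 (lexx 0)) _ (fun v => - q (- v))).
- by move=> t v; exact: shift_inf_lb.
- move=> [s s0] [t t0] x y; exists (exist _ (s + t) (addr_ge0 s0 t0)) => /=.
  have := sD (x + s *: w) (y + t *: w).
  by rewrite scalerDl addrACA mulrDl; lra.
- move=> [s s0] a x a0.
  exists (exist _ (a * s) (mulr_ge0 (ltW a0) s0)) => /=.
  by rewrite -scalerA -scalerDr sZ// mulrBr mulrA.
Qed.

(** Zorn's lemma for the reversed pointwise order: a nonempty chain is bounded by its pointwise
    infimum, which stays above [- p (- x)]. *)
Lemma sublinear_min p : sublinear p -> exists q,
  [/\ sublinear q, forall x, q x <= p x &
   forall q', sublinear q' -> (forall x, q' x <= q x) -> forall x, q x <= q' x].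
Proof.
move=> sp.
pose T := {q : V -> R | sublinear q /\ forall x, q x <= p x}.
pose le (q1 q2 : T) := `[< forall x, sval q2 x <= sval q1 x >].
have [|||[q [sq qp]] qmin] :=
  @ZL_preorder T (exist _ p (conj sp (fun=> lexx _))) le.
- by move=> q; exact/asboolP.
- move=> q1 q2 q3 /asboolP q12 /asboolP q23; apply/asboolP => x.
  exact: le_trans (q23 x) (q12 x).
- move=> A Atot; have [[q0 Aq0]|A0] := pselect (A !=set0); last first.
    by exists (exist _ p (conj sp (fun=> lexx _))) => q Aq; case: A0; exists q.
  pose h (q : {q : T | A q}) : V -> R := sval (sval q).
  have hm (q : {q | A q}) x : - p (- x) <= h q x.
    case: q => -[q [sq qp]] Aq; rewrite /h/=.
    by have := sublinear_ge_opp x sq; have := qp (- x); lra.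
  have hle (q : {q : T | A q}) x : inf_fun h x <= h q x.
    by apply: (@inf_fun_le _ _ _ (- p (- x))) => j; exact: hm.
  suff sh : sublinear (inf_fun h).
    have shp : forall x, inf_fun h x <= p x.
      move=> x; apply: le_trans (hle (exist _ q0 Aq0) x) _.
      by rewrite /h/=; case: (q0) => q [].
    exists (exist (fun q => sublinear q /\ forall x, q x <= p x) (inf_fun h)
      (conj sh shp)) => q Aq; apply/asboolP => x /=.
    exact: (hle (exist _ q Aq)).
  apply: (@sublinear_inf _ (exist _ q0 Aq0) h (fun x => - p (- x))) => //.
  + move=> [q1 A1] [q2 A2] x y.
    have [/asboolP q12|/asboolP q21] := Atot _ _ A1 A2.
    * exists (exist _ q2 A2); rewrite /h/=.
      by have := q12 x; have [sD _] := (svalP q2).1; have := sD x y; lra.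
    * exists (exist _ q1 A1); rewrite /h/=.
      by have := q21 y; have [sD _] := (svalP q1).1; have := sD x y; lra.
  + move=> [q1 A1] a x a0; exists (exist _ q1 A1); rewrite /h/=.
    by have [_ ->] := (svalP q1).1.
exists q; split=> // q' sq' q'q.
have q'p x : q' x <= p x by exact: le_trans (q'q x) (qp x).
have /asboolP := qmin (exist _ q' (conj sq' q'p)) ltac:(exact/asboolP).
by [].
Qed.

Definition linear_form (f : V -> R) : Prop :=
  (forall x y, f (x + y) = f x + f y) /\
  (forall a x, f (a *: x) = a * f x).

Lemma linear_formN f x : linear_form f -> f (- x) = - f x.
Proof. by case=> _ fZ; rewrite -scaleN1r fZ mulN1r. Qed.

Lemma linear_formB f x y : linear_form f -> f (x - y) = f x - f y.
Proof. by move=> lf; rewrite lf.1 linear_formN. Qed.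

(** The minimal functional is taken below [shift_inf p w] rather than [p]: its value at [- w] is
    then at most [- p w], and oddness forces equality at [w]. *)
Lemma hahn_banach p w : sublinear p ->
  exists f, [/\ linear_form f, forall x, f x <= p x & f w = p w].
Proof.
move=> sp; have [q [sq qpw qmin]] := sublinear_min (sublinear_shift_inf w sp).
have [sD sZ] := sq.
have qN v : q (- v) = - q v.
  apply/eqP; rewrite eq_le; apply/andP; split; last first.
    by have := sublinear_ge_opp v sq; lra.
  apply: le_trans (qmin _ (sublinear_shift_inf v sq) _ _) _ => [x|].
    apply: (le_trans (shift_inf_le v x sq (lexx 0))).
    by rewrite scale0r addr0 mul0r subr0.
  apply: (le_trans (shift_inf_le v (- v) sq ler01)).
  by rewrite scale1r addNr sublinear0// mul1r sub0r.
have qp x : q x <= p x.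
  apply: le_trans (qpw x) _; apply: (le_trans (shift_inf_le w x sp (lexx 0))).
  by rewrite scale0r addr0 mul0r subr0.
exists q; split=> //; first split.
- move=> x y; apply/eqP; rewrite eq_le sD/=.
  by have := sD (- x) (- y); rewrite -opprD !qN; lra.
- move=> a x; have [a0|a0|->] := ltgtP a 0.
  + by rewrite -[a in LHS]opprK scaleNr qN sZ ?oppr_gt0// mulNr opprK.
  + exact: sZ.
  + by rewrite scale0r mul0r sublinear0.
- apply/eqP; rewrite eq_le qp/=.
  have := le_trans (qpw (- w)) (shift_inf_le w (- w) sp ler01).
  by rewrite scale1r addNr sublinear0// mul1r qN; lra.
Qed.

End HahnBanach.

(** * Subgradients of convex functions and the derivative of the norm *)

Section Subgradient.
Variables (R : realType) (X : normedModType R).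
Implicit Types (f g : X -> R) (u v w x y z : X).

Lemma linear_form_abs_le f x : linear_form f -> (forall v, f v <= `|v|) ->
  `|f x| <= `|x|.
Proof.
move=> lf fn; rewrite ler_norml fn andbT lerNl -linear_formN//.
by apply: le_trans (fn _) _; rewrite normrN.
Qed.

(** The infimum of the difference quotients of [g] at [z] is the one-sided directional derivative,
    which is sublinear. Hahn-Banach, exact at [w], yields a subgradient attaining it in that
    direction. *)
Lemma subgradient g z w :
  (forall (t : R) x y, 0 <= t <= 1 ->
    g (t *: x + (1 - t) *: y) <= t * g x + (1 - t) * g y) ->
  (forall x y, g x - g y <= `|x - y|) ->
  exists f, [/\ linear_form f, forall v, f v <= `|v|,
    forall v, f v <= g (z + v) - g z &
    forall k, 0 < k -> exists2 d, 0 < d &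
      forall s, 0 < s <= d -> g (z + s *: w) <= g z + s * (f w + k)].
Proof.
move=> gC gL.
pose h (s : {s : R | 0 < s}) v := (g (z + sval s *: v) - g z) / sval s.
have hm s v : - `|v| <= h s v.
  case: s => s s0; rewrite /h/= ler_pdivlMr// mulNr mulrC.
  have := gL z (z + s *: v).
  by rewrite opprD addrA subrr add0r normrN normrZ gtr0_norm//; lra.
have le s v : inf_fun h v <= h s v.
  by apply: (@inf_fun_le _ _ _ h v (- `|v|)) => j.
have sh : sublinear (inf_fun h).
  apply: (@sublinear_inf _ _ _ (exist _ 1 ltr01) h (fun v => - `|v|)) => //.
  - move=> [s s0] [t t0] x y.
    have st0 : 0 < s + t by exact: addr_gt0.
    (* This step is the one for which [z + k *: (x + y)] is a convex combination of [z + s *: x] and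
       [z + t *: y]. *)
    have k0 : 0 < s * t / (s + t) by rewrite divr_gt0// mulr_gt0.
    exists (exist (fun s : R => 0 < s) _ k0); rewrite /h/=.
    have t01 : 0 <= t / (s + t) <= 1.
      by rewrite divr_ge0 ?(ltW t0) ?(ltW st0)//= ler_pdivrMr// mul1r; lra.
    have := gC (t / (s + t)) (z + s *: x) (z + t *: y) t01.
    have -> : t / (s + t) *: (z + s *: x) + (1 - t / (s + t)) *: (z + t *: y)
       = z + (s * t / (s + t)) *: (x + y).
      rewrite !scalerDr addrACA -scalerDl [_ + (1 - _)]addrC subrK scale1r !scalerA.
      by congr (_ + (_ *: _ + _ *: _)); field; lra.
    rewrite ler_pdivrMr//.
    set g1 := g (z + s *: x); set g2 := g (z + t *: y) => H.
    have -> : ((g1 - g z) / s + (g2 - g z) / t) * (s * t / (s + t)) =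
      t / (s + t) * g1 + (1 - t / (s + t)) * g2 - g z.
      by field; rewrite !lt0r_neq0.
    by lra.
  - move=> [s s0] a x a0; exists (exist (fun s : R => 0 < s) _ (divr_gt0 s0 a0)).
    rewrite /h/= scalerA divfK ?lt0r_neq0//.
    by rewrite le_eqVlt; apply/orP; left; apply/eqP; field; rewrite !lt0r_neq0.
have [f [lf fh fw]] := hahn_banach w sh.
exists f; split=> //.
- move=> v; have := le_trans (fh v) (le (exist _ 1 ltr01) v).
  rewrite /h/= divr1 scale1r => /le_trans; apply.
  by apply: le_trans (gL _ _) _; rewrite addrAC subrr add0r.
- move=> v; have := le_trans (fh v) (le (exist _ 1 ltr01) v).
  by rewrite /h/= divr1 scale1r.
- move=> k k0.
  have [[d d0] hd] : exists s, h s w < f w + k.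
    apply: contrapT => /forallNP H.
    suff : f w + k <= inf_fun h w by rewrite fw; lra.
    apply: (inf_fun_ge (exist _ 1 ltr01)) => s.
    by rewrite leNgt; apply/negP; exact: H.
  (* By convexity the quotient does not grow when the step shrinks below [d]. *)
  exists d => // s /andP[s0 sd].
  have sd1 : 0 <= s / d <= 1.
    by rewrite divr_ge0 ?(ltW s0) ?(ltW d0)//= ler_pdivrMr// mul1r.
  have := gC (s / d) (z + d *: w) z sd1.
  rewrite scalerDr addrAC -scalerDl [_ + (1 - _)]addrC subrK scale1r.
  rewrite scalerA divfK ?lt0r_neq0//.
  rewrite addrC.
  move: hd; rewrite /h/= ltr_pdivrMr//.
  set g1 := g (z + d *: w) => hd.
  have : s / d * (g1 - g z) <= s / d * ((f w + k) * d).
    by rewrite ler_wpM2l ?(ltW hd)//; case/andP : sd1.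
  have -> : s / d * ((f w + k) * d) = s * (f w + k) by field; exact: lt0r_neq0.
  by lra.
Qed.

Lemma norm_subgradient z w :
  exists f, [/\ linear_form f, forall v, f v <= `|v|, f z = `|z| &
    forall k, 0 < k -> exists2 d, 0 < d &
      forall s, 0 < s <= d -> `|z + s *: w| <= `|z| + s * (f w + k)].
Proof.
have [||f [lf fn fz fw]] := @subgradient (fun x => `|x|) z w.
- move=> t x y /andP[t0 t1]; apply: le_trans (ler_normD _ _) _.
  by rewrite !normrZ !ger0_norm// subr_ge0.
- by move=> x y; exact: lerB_dist.
(* The subgradient inequality in direction [- z] gives [|z| <= f z]. *)
exists f; split=> //; apply/eqP; rewrite eq_le fn/=.
by have := fz (- z); rewrite subrr normr0 linear_formN//; lra.
Qed.

Lemma linear_form_continuous f : linear_form f -> (forall v, f v <= `|v|) ->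
  continuous f.
Proof.
move=> lf fn x; apply/cvgrPdist_lt => e e0; near=> y.
rewrite -linear_formB//; apply: (le_lt_trans (linear_form_abs_le _ lf fn)).
near: y; exact: (@cvgr_dist_lt _ _ _ _ _ id).
Unshelve. all: by end_near. Qed.

Lemma linear_form_dual f : linear_form f -> (forall v, f v <= `|v|) -> is_dual f.
Proof.
by move=> lf fn; case: (lf) => fD fZ; do 2!split=> //; exact: linear_form_continuous.
Qed.

Lemma support_functional u f : u != 0 -> linear_form f ->
  (forall v, f v <= `|v|) -> f u = `|u| ->
  is_dual f /\ opnorm f = 1 /\ f (`|u|^-1 *: u) = 1.
Proof.
move=> u0 lf fn fu.
have nu0 : `|u| != 0 by rewrite normr_eq0.
have fu1 : f (`|u|^-1 *: u) = 1 by rewrite lf.2 fu mulVf.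
have u1 : `| `|u|^-1 *: u| = 1 by rewrite normrZ normfV normr_id mulVf.
split; first exact: linear_form_dual.
split=> //; apply/eqP; rewrite eq_le; apply/andP; split.
  apply: ge_sup; first by exists `|f 0|, 0 => //=; rewrite normr0.
  by move=> _ [x /= x1 <-]; exact: le_trans (linear_form_abs_le x lf fn) x1.
apply: ub_le_sup.
  exists 1 => _ [x /= x1 <-]; exact: le_trans (linear_form_abs_le x lf fn) x1.
by exists (`|u|^-1 *: u) => /=; rewrite ?u1// fu1 normr1.
Qed.

(** Each direction has its own support functional attaining the derivative there; smoothness
    identifies them all, so one [f] serves every [w]. *)
Lemma smooth_gateaux u : smooth_space X -> u != 0 ->
  exists f, [/\ linear_form f, forall v, f v <= `|v|, f u = `|u| &
    forall w k, 0 < k -> exists2 d, 0 < d &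
      forall s, 0 < s <= d -> `|u + s *: w| <= `|u| + s * (f w + k)].
Proof.
move=> sX u0; have [f [lf fn fu _]] := norm_subgradient u 0.
exists f; split=> // w.
have [f' [lf' fn' fu' f'w]] := norm_subgradient u w.
suff -> : f = f' by [].
have u1 : `| `|u|^-1 *: u| = 1.
  by rewrite normrZ normfV normr_id mulVf// normr_eq0.
have [f0 [_ f0u]] := sX _ u1.
by rewrite -(f0u f (support_functional u0 lf fn fu))
           -(f0u f' (support_functional u0 lf' fn' fu')).
Qed.

End Subgradient.

(** * Difference quotients of the squared norm *)

Section SquareQuotient.
Variables (R : realType) (X : normedModType R).
Implicit Types (s t k : R) (u v x c d e : X).

(* Nondecreasing in [s > 0], with limit [2 J(u)(v)] as [s -> 0]. *)
Definition sqquot s u v : R := (`|u + s *: v| ^+ 2 - `|u| ^+ 2) / s.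

Lemma sqquot_mono s t u v : 0 < s -> s <= t -> sqquot s u v <= sqquot t u v.
Proof.
move=> s0 st; have t0 : 0 < t by exact: lt_le_trans st.
pose l := s / t.
have l0 : 0 <= l by rewrite divr_ge0 ?ltW.
have l1 : l <= 1 by rewrite ler_pdivrMr// mul1r.
have lt : l * t = s by rewrite /l divfK ?lt0r_neq0.
have ls : s / t = l by [].
clearbody l.
have H : `|u + s *: v| <= l * `|u + t *: v| + (1 - l) * `|u|.
  have -> : u + s *: v = l *: (u + t *: v) + (1 - l) *: u.
    by rewrite scalerDr addrAC -scalerDl [_ + (1 - _)]addrC subrK scale1r scalerA lt.
  apply: le_trans (ler_normD _ _) _.
  by rewrite !normrZ (ger0_norm l0) ger0_norm ?subr_ge0.
rewrite /sqquot ler_pdivrMr// mulrAC -mulrA ls.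
have a0 := normr_ge0 (u + t *: v); have b0 := normr_ge0 u.
have := normr_ge0 (u + s *: v); move: H.
move: (`|u + s *: v|) (`|u + t *: v|) (`|u|) a0 b0 => c a b a0 b0 H c0.
have : c ^+ 2 <= (l * a + (1 - l) * b) ^+ 2 by rewrite ler_sqr ?nnegrE// (le_trans c0).
(* This is the convexity gap of the square between [a] and [b] with weight [l]. *)
have : 0 <= l * (1 - l) * (a - b) ^+ 2.
  by rewrite mulr_ge0 ?sqr_ge0// mulr_ge0// subr_ge0.
by nra.
Qed.

(** As [J(- u) = - J(u)] and [J(u)(u) = |u|^2], the limits [2 J(u)(v)] and [2 J(- u)(u + v)] add up
    to [- 2 |u|^2]. In the application [u = d - c], [v = x - d] and [u + v = x - c]. *)
Lemma sqquot_sym_small u v k : smooth_space X -> 0 < k ->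
  exists2 s, 0 < s &
    sqquot s u v + sqquot s (- u) (u + v) + 2 * `|u| ^+ 2 < k.
Proof.
move=> sX k0; have [->|u0] := eqVneq u 0.
  have s0 : 0 < k / (2 * `|v| ^+ 2 + 1).
    by rewrite divr_gt0//; have := sqr_ge0 `|v|; lra.
  exists (k / (2 * `|v| ^+ 2 + 1)) => //.
  rewrite /sqquot oppr0 !add0r normr0 expr0n/= mulr0 addr0 subr0.
  rewrite normrZ (gtr0_norm s0).
  have := sqr_ge0 `|v|; move: s0; move: (`|v|) => n + n0; set s := (X in 0 < X) => s0.
  have sE : s * (2 * n ^+ 2 + 1) = k by rewrite divfK// lt0r_neq0//; lra.
  have -> : (s * n) ^+ 2 / s = s * n ^+ 2 by field; exact: lt0r_neq0.
  by nra.
have [f [lf fn fu fd]] := smooth_gateaux sX u0.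
have nu0 : 0 < `|u| by rewrite normr_gt0.
(* The two derivative errors [h] cost [4 |u| h = k / 2] in all; [d3] keeps the second-order term
   [s * (A^2 + B^2)] below the other half. *)
pose h := k / (8 * `|u|).
have h0 : 0 < h by rewrite divr_gt0// mulr_gt0.
pose A := f v + h; pose B := f (- (u + v)) + h.
have [d1 d10 H1] := fd v h h0; have [d2 d20 H2] := fd (- (u + v)) h h0.
have K0 : 0 <= A ^+ 2 + B ^+ 2 by rewrite addr_ge0 ?sqr_ge0.
pose d3 := k / (2 * (A ^+ 2 + B ^+ 2) + 1).
have d30 : 0 < d3 by rewrite divr_gt0//; lra.
pose s := Num.min d1 (Num.min d2 d3).
have s0 : 0 < s by rewrite !lt_min d10 d20 d30.
have sd1 : s <= d1 by rewrite ge_min lexx.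
have sd2 : s <= d2 by rewrite !ge_min lexx orbT.
have sd3 : s <= d3 by rewrite !ge_min lexx !orbT.
exists s => //.
have sq w C : `|u + s *: w| <= `|u| + s * C ->
    sqquot s u w <= 2 * `|u| * C + s * C ^+ 2.
  move=> uw; rewrite /sqquot ler_pdivrMr//.
  have := normr_ge0 (u + s *: w); move: uw; move: (`|u + s *: w|) => a ua a0.
  have : a ^+ 2 <= (`|u| + s * C) ^+ 2 by rewrite ler_sqr ?nnegrE// (le_trans a0).
  by nra.
have -> : sqquot s (- u) (u + v) = sqquot s u (- (u + v)).
  by rewrite /sqquot scalerN normrN -[- u + _]opprK opprD opprK normrN.
have := sq _ _ (H1 s ltac:(by rewrite s0)); rewrite -/A => Q1.
have := sq _ _ (H2 s ltac:(by rewrite s0)); rewrite -/B => Q2.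
have ABE : A + B = 2 * h - `|u|.
  by rewrite /A /B linear_formN// lf.1 fu; ring.
have hE : 4 * `|u| * h = k / 2 by rewrite /h; field; exact: lt0r_neq0.
have sK : s * (2 * (A ^+ 2 + B ^+ 2) + 1) <= k.
  by rewrite -ler_pdivlMr//; lra.
have : 2 * `|u| * A + 2 * `|u| * B = k - 2 * `|u| ^+ 2 - k / 2.
  by rewrite -mulrDr ABE -hE; lra.
by nra.
Qed.

Lemma sqquot_cvg (U : set_system nat) (FU : Filter U) s (u_ v_ : nat -> X) u v :
  u_ @ U --> u -> v_ @ U --> v ->
  (fun n => sqquot s (u_ n) (v_ n)) @ U --> sqquot s u v.
Proof.
move=> uc vc; rewrite /sqquot.
have nc : (fun n => `|u_ n + s *: v_ n|) @ U --> `|u + s *: v|.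
  by apply: cvg_norm; apply: cvgD => //; exact: cvgZr.
have nu : (fun n => `|u_ n|) @ U --> `|u| by exact: cvg_norm.
apply: cvgMl; apply: cvgB; rewrite expr2.
  by under eq_fun do rewrite expr2; exact: cvgM.
by under eq_fun do rewrite expr2; exact: cvgM.
Qed.

End SquareQuotient.

(** Summing over [m] and symmetrizing bounds the double sum of [e] by [3/2 * N^2 * h]; if every [m]
    failed, it would be at least [2 * N^2 * h]. *)
Lemma double_average (R : realType) (N : nat) (q e : nat -> nat -> R) (h : R) :
  (0 < N)%N -> 0 < h ->
  (forall m, (m < N)%N -> - (N%:R * h) <= \sum_(n < N) q n m) ->
  (forall n m, q n m + q m n <= h - 2 * e n m) ->
  exists2 m, (m < N)%N & \sum_(n < N) e n m <= 2 * (N%:R * h).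
Proof.
move=> N0 h0 qN qe; apply: contrapT => nex.
have eN (m : 'I_N) : 2 * (N%:R * h) <= \sum_(n < N) e n m.
  rewrite leNgt; apply/negP => H; apply: nex.
  by exists (val m); [exact: ltn_ord | exact: ltW].
have sumc (a : R) : \sum_(i < N) a = N%:R * a.
  by rewrite sumr_const card_ord mulr_natl.
have NR : (0 : R) < N%:R by rewrite ltr0n.
have S1 : - (N%:R * (N%:R * h)) <= \sum_(m < N) \sum_(n < N) q n m.
  rewrite -mulrN -(sumc (- (N%:R * h))).
  by apply: ler_sum => m _; exact: qN.
have S2 : N%:R * (2 * (N%:R * h)) <= \sum_(m < N) \sum_(n < N) e n m.
  by rewrite -(sumc (2 * (N%:R * h))); exact: ler_sum.
have S3 : 2 * (\sum_(m < N) \sum_(n < N) q n m) <=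
    N%:R * (N%:R * h) - 2 * (\sum_(m < N) \sum_(n < N) e n m).
  (* Exchanging the sums in one of two copies pairs [q n m] with [q m n]. *)
  rewrite [2 * _ in leLHS]mulr_natl mulr2n [X in _ + X]exchange_big -big_split/=.
  rewrite -(sumc (N%:R * h)) mulr_sumr -sumrB.
  apply: ler_sum => m _.
  rewrite -big_split/= -(sumc h).
  by rewrite mulr_sumr -sumrB; apply: ler_sum => n _; exact: qe.
have : 0 < N%:R * (N%:R * h) by rewrite !mulr_gt0.
by lra.
Qed.

(** An ultrafilter converges to each of its cluster points. This replaces the extraction of
    subsequences. *)
Lemma compact_ultra_cvg (I : Type) (T : topologicalType) (K : set T)
    (U : set_system I) (g : I -> T) : UltraFilter U -> compact K ->
  (\forall i \near U, K (g i)) -> exists2 p, K p & g @ U --> p.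
Proof.
move=> UU cK gK; have [p [Kp gp]] := cK (g @ U) _ gK; exists p => // V Vp.
have [//|UnV] := in_ultra_setVsetC (g @^-1` V) UU.
by have [y [nVy Vy]] := gp (~` V) V UnV Vp.
Qed.

(** * Nonexpansive retraction onto a compact existence set *)

Section CompactExistenceSet.
Variables (R : realType) (X : normedModType R).
Implicit Types (F : set X) (x y c d : X).

Lemma free_ultrafilter : exists2 U : set_system nat, UltraFilter U & \oo `<=` U.
Proof. by have [U [UU sU]] := ultraFilterLemma eventually_filter; exists U. Qed.

(** A Dini argument: [sqquot_sym_small] is a pointwise bound, monotone in the step, and a limit of
    bad pairs would contradict it. *)
Lemma sqquot_sym_uniform F x (h t : R) : smooth_space X -> compact F ->
  0 < h -> 0 < t -> exists2 s, 0 < s <= t & forall d c, F d -> F c ->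
    sqquot s (d - c) (x - d) + sqquot s (c - d) (x - c) <= h - 2 * `|d - c| ^+ 2.
Proof.
move=> sX cF h0 t0; apply: contrapT => nex.
pose G s d c := sqquot s (d - c) (x - d) + sqquot s (c - d) (x - c) +
  2 * `|d - c| ^+ 2.
have Gmono s s' d c : 0 < s -> s <= s' -> G s d c <= G s' d c.
  by move=> s0 ss'; rewrite /G lerD2r lerD// sqquot_mono.
(* By monotonicity a pair bad for the step [t / n.+1] is bad for all larger ones, so a fixed [s] can
   be tested in the limit. *)
have bad (n : nat) : exists dc : X * X, [/\ F dc.1, F dc.2 &
    forall s, t / n.+1%:R <= s -> h < G s dc.1 dc.2].
  have s0 : 0 < t / n.+1%:R by rewrite divr_gt0.
  apply: contrapT => H; apply: nex; exists (t / n.+1%:R).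
    by rewrite s0 ler_pdivrMr// (ler_peMr (ltW t0)) ?ler1n.
  move=> d c Fd Fc; rewrite lerBrDr leNgt; apply/negP => hG.
  apply: H; exists (d, c); split=> // s st; exact: lt_le_trans hG (Gmono _ _ _ _ s0 st).
have [dc dcP] := choice bad.
have [U UU sU] := free_ultrafilter.
have [|d Fd dd] := compact_ultra_cvg (g := fun n => (dc n).1) UU cF.
  by apply: nearW => n; case: (dcP n).
have [|c Fc cc] := compact_ultra_cvg (g := fun n => (dc n).2) UU cF.
  by apply: nearW => n; case: (dcP n).
have [s s0 sG] := sqquot_sym_small (d - c) (x - d) sX h0.
have {}sG : G s d c < h.
  rewrite /G -[c - d]opprB; suff -> : x - c = (d - c) + (x - d) by [].
  by rewrite [RHS]addrC addrA subrK.
have Gc : (fun n => G s (dc n).1 (dc n).2) @ U --> G s d c.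
  apply: cvgD; first apply: cvgD.
  - by apply: sqquot_cvg; apply: cvgB => //; exact: cvg_cst.
  - by apply: sqquot_cvg; apply: cvgB => //; exact: cvg_cst.
  - apply: cvgMr; rewrite expr2; under eq_fun do rewrite expr2.
    by apply: cvgM; apply: cvg_norm; exact: cvgB.
have /cvgr_lt/(_ _ sG) Glt := Gc.
have sN : \forall n \near U, t / n.+1%:R <= s.
  apply: sU; apply: filterS (nbhs_infty_ger (t / s)) => n tsn.
  rewrite ler_pdivrMr// mulrC -ler_pdivrMr//.
  by apply: le_trans tsn _; rewrite ler_nat.
have [n [Gn sn]] := filter_ex (filterI Glt sN).
by have [_ _ /(_ s sn)] := dcP n; rewrite ltNge ltW.
Qed.

Lemma co_approx_orbit F x s : existence_set F -> 0 < s -> exists d_ : nat -> X,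
  (forall n, F (d_ n)) /\ forall n c, F c ->
    `|d_ n.+1 - c| ^+ 2 - `|d_ n - c| ^+ 2 <= s * sqquot s (d_ n - c) (x - d_ n).
Proof.
move=> [[d0 Fd0] Fex] s0; have [r rP] := choice Fex.
pose d_ n := iter n (fun e => r (e + s *: (x - e))) d0.
exists d_; split=> [[//|n]|n c Fc].
  by case: (rP (d_ n + s *: (x - d_ n))).
have [_ /(_ c Fc)] := rP (d_ n + s *: (x - d_ n)).
rewrite -[r _]/(d_ n.+1) addrAC => H.
rewrite /sqquot mulrC divfK ?lt0r_neq0// lerD2r.
by rewrite ler_sqr ?nnegrE.
Qed.

Lemma compact_norm_le F : compact F ->
  exists2 M, 0 <= M & forall y, F y -> `|y| <= M.
Proof.
move=> /compact_bounded[M [_ HM]].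
exists (`|M| + 1) => [|y Fy]; first by rewrite addr_ge0.
by apply: HM => //; rewrite (le_lt_trans (ler_norm M))// ltrDl.
Qed.

(** Serves to replace [d_n] by the nearby [d_m]; the constant may blow up as [s] tends to 0. *)
Lemma sqquot_lip F x s : compact F -> 0 < s <= 1 -> exists2 K, 0 <= K &
  forall d e c, F d -> F e -> F c ->
    sqquot s (d - c) (x - d) <= sqquot s (e - c) (x - e) + K * `|d - e|.
Proof.
move=> cF /andP[s0 s1].
have [M M0 FM] := compact_norm_le cF.
(* On a ball of radius [L] the squared norm is [2 L]-Lipschitz; the radii are [3 M + |x|] for the
   shifted vectors and [2 M] for the differences. *)
exists ((2 * (3 * M + `|x|) + 4 * M) / s).
  by rewrite divr_ge0 ?(ltW s0)//; have := normr_ge0 x; lra.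
move=> d e c Fd Fe Fc.
rewrite /sqquot mulrAC -mulrDl ler_pM2r ?invr_gt0//.
have nB a b : F a -> F b -> `|a - b| <= 2 * M.
  move=> Fa Fb; apply: le_trans (ler_normB _ _) _.
  by have := FM a Fa; have := FM b Fb; lra.
have nQ a : F a -> `|a - c + s *: (x - a)| <= 3 * M + `|x|.
  move=> Fa; apply: le_trans (ler_normD _ _) _.
  have : `|s *: (x - a)| <= `|x| + M.
    rewrite normrZ gtr0_norm//.
    have : `|x - a| <= `|x| + M by apply: le_trans (ler_normB _ _) _; rewrite lerD2l FM.
    by have := normr_ge0 (x - a); nra.
  by have := nB a c Fa Fc; lra.
have sqB (a b : X) L : `|a| <= L -> `|b| <= L ->
    `|a| ^+ 2 - `|b| ^+ 2 <= 2 * L * `|a - b|.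
  move=> aL bL; have := lerB_dist a b; have := normr_ge0 (a - b).
  move: (normr_ge0 a) (normr_ge0 b) aL bL.
  by move: (`|a|) (`|b|) (`|a - b|) => A B D; nra.
have H1 := sqB _ _ _ (nQ d Fd) (nQ e Fe).
have H2 := sqB _ _ _ (nB e c Fe Fc) (nB d c Fd Fc).
have E1 : d - c + s *: (x - d) - (e - c + s *: (x - e)) = (1 - s) *: (d - e).
  have E a : a - c + s *: (x - a) = (1 - s) *: a + (s *: x - c).
    rewrite scalerBl scale1r scalerBr [s *: x - s *: a]addrC addrACA.
    by rewrite [- c + _]addrC.
  by rewrite !E opprD addrACA subrr addr0 -scalerBr.
have E2 : e - c - (d - c) = - (d - e) by rewrite !opprB addrA subrK.
move: H1 H2; rewrite E1 E2 normrN normrZ ger0_norm ?subr_ge0// => H1 H2.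
have K0 : 0 <= 3 * M + `|x| by have := normr_ge0 x; lra.
have : s * (3 * M + `|x|) * `|d - e| >= 0 by rewrite mulr_ge0// mulr_ge0// ltW.
by lra.
Qed.

Lemma co_approx_near F x t : smooth_space X -> compact F -> existence_set F ->
  0 < t <= 1 ->
  exists2 d, F d & forall c, F c -> - t <= sqquot t (d - c) (x - d).
Proof.
move=> sX cF eF t01; have [t0 t1] := andP t01.
have [K K0 FK] := sqquot_lip x cF t01; have [M M0 FM] := compact_norm_le cF.
(* Chosen so that [h + K^2 h / t = t / 2]. There is no circularity: [K] depends on the coarse step
   [t] only, and the fine step [s] is picked after [h]. *)
pose h := t ^+ 2 / (2 * (t + K ^+ 2)).
have tK0 : 0 < t + K ^+ 2 by have := sqr_ge0 K; lra.
have h0 : 0 < h by rewrite divr_gt0 ?exprn_gt0// mulr_gt0.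
have hE : 2 * (t + K ^+ 2) * h = t ^+ 2.
  by rewrite mulrC divfK// lt0r_neq0// mulr_gt0.
have [s /andP[s0 st] sF] := sqquot_sym_uniform x sX cF h0 t0.
have [d_ [Fd dS]] := co_approx_orbit x eF s0.
have sh0 : 0 < s * h by exact: mulr_gt0.
(* The telescoped sum is at least [- (2 M)^2], which this [N] absorbs into [- N s h]. *)
pose N := (Num.truncn ((2 * M) ^+ 2 / (s * h))).+1.
have NR : (2 * M) ^+ 2 <= N%:R * (s * h).
  by rewrite -ler_pdivrMr//; apply/ltW; exact: truncnS_gt.
have N0 : (0 : R) < N%:R by rewrite ltr0n.
have sumQ c : F c -> - (N%:R * h) <= \sum_(n < N) sqquot s (d_ n - c) (x - d_ n).
  move=> Fc; rewrite -(ler_pM2l s0) mulr_sumr.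
  apply: (@le_trans _ _
    (\sum_(n < N) (`|d_ n.+1 - c| ^+ 2 - `|d_ n - c| ^+ 2))); last first.
    by apply: ler_sum => n _; exact: dS.
  rewrite -(big_mkord xpredT (fun n => `|d_ n.+1 - c| ^+ 2 - `|d_ n - c| ^+ 2)).
  rewrite telescope_sumr//=.
  have d0M : `|d_ 0%N - c| <= 2 * M.
    apply: le_trans (ler_normB _ _) _.
    by have := FM _ (Fd 0%N); have := FM _ Fc; lra.
  have : `|d_ 0%N - c| ^+ 2 <= (2 * M) ^+ 2 by rewrite ler_sqr ?nnegrE ?mulr_ge0.
  by have := sqr_ge0 `|d_ N - c|; lra.
have [||m mN em] := @double_average R N
  (fun n m => sqquot s (d_ n - d_ m) (x - d_ n))
  (fun n m => `|d_ n - d_ m| ^+ 2) h isT h0.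
- by move=> m _; exact: sumQ.
- by move=> n m; exact: sF.
exists (d_ m) => // c Fc.
(* Coarsen the step from [s] to [t], move [d_n] to [d_m], and split the error by
   [K a <= t / 2 + K^2 a^2 / (2 t)]. *)
have : \sum_(n < N) sqquot s (d_ n - c) (x - d_ n) <=
    \sum_(n < N) (sqquot t (d_ m - c) (x - d_ m) + t / 2 +
                  K ^+ 2 / (2 * t) * `|d_ n - d_ m| ^+ 2).
  apply: ler_sum => n _.
  apply: (le_trans (sqquot_mono _ _ s0 st)).
  apply: le_trans (FK _ (d_ m) _ (Fd n) (Fd m) Fc) _.
  rewrite -addrA lerD2l; move: (`|d_ n - d_ m|) => a.
  have -> : t / 2 + K ^+ 2 / (2 * t) * a ^+ 2 = K * a + (t - K * a) ^+ 2 / (2 * t).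
    by field; exact: lt0r_neq0.
  by rewrite lerDl divr_ge0 ?sqr_ge0// mulr_ge0// ltW.
rewrite big_split/= sumr_const card_ord -mulr_natl -mulr_sumr => H.
have := le_trans (sumQ c Fc) H; move: em.
set E := \sum_(_ < _) _; set q := sqquot t _ _ => EN.
have : K ^+ 2 / (2 * t) * E <= K ^+ 2 / (2 * t) * (2 * (N%:R * h)).
  by rewrite ler_wpM2l// divr_ge0 ?sqr_ge0// mulr_ge0// ltW.
have -> : K ^+ 2 / (2 * t) * (2 * (N%:R * h)) = N%:R * (t / 2 - h).
  have -> : K ^+ 2 = t ^+ 2 / (2 * h) - t by rewrite -hE; field; exact: lt0r_neq0.
  by field; rewrite !lt0r_neq0.
move=> H1 H2.
have : 0 <= N%:R * (q + t) by lra.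
by rewrite pmulr_rge0//; lra.
Qed.

(** Encodes [J(d - c)(x - d) >= 0] through quotients, whose infimum over the steps is twice this
    derivative. For a fixed step the condition passes to limits. *)
Definition co_approx F x d : Prop := F d /\
  forall c s, F c -> 0 < s <= 1 -> 0 <= sqquot s (d - c) (x - d).

(** For fixed [s], monotonicity carries the approximate inequality at step [1 / n.+1] up to [s] once
    [1 / n.+1 <= s]; then pass to the limit. *)
Lemma co_approx_exists F x : smooth_space X -> compact F -> existence_set F ->
  exists d, co_approx F x d.
Proof.
move=> sX cF eF.
have near n : exists d, F d /\
    forall c, F c -> - n.+1%:R^-1 <= sqquot n.+1%:R^-1 (d - c) (x - d).
  have n01 : 0 < (n.+1%:R^-1 : R) <= 1.
    by rewrite invr_gt0 ltr0n/= invf_le1 ?ltr0n ?ler1n.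
  by have [d] := co_approx_near x sX cF eF n01; exists d.
have [d_ dP] := choice near.
have [U UU sU] := free_ultrafilter.
have [|d Fd dd] := compact_ultra_cvg (g := d_) UU cF.
  by apply: nearW => n; case: (dP n).
exists d; split=> // c s Fc /andP[s0 _].
apply/ler_addgt0Pr => e e0; rewrite -lerBlDr sub0r.
have Qc : (fun n => sqquot s (d_ n - c) (x - d_ n)) @ U --> sqquot s (d - c) (x - d).
  by apply: sqquot_cvg; apply: cvgB => //; exact: cvg_cst.
apply: (cvgr_to_ge Qc).
have small (k : R) : 0 < k -> \forall n \near U, n.+1%:R^-1 <= k.
  move=> k0; apply: sU; apply: filterS (nbhs_infty_ger k^-1) => n kn.
  rewrite -[k]invrK lef_pV2 ?posrE ?invr_gt0 ?ltr0n//.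
  by apply: le_trans kn _; rewrite ler_nat.
apply: filterS2 (small _ s0) (small _ e0) => n ns ne.
have [_ /(_ c Fc) Qn] := dP n.
apply: le_trans (sqquot_mono _ _ _ ns); last by rewrite invr_gt0 ltr0n.
by apply: le_trans Qn; rewrite lerN2.
Qed.

Lemma co_approx_nonexpansive F x y d e : smooth_space X ->
  co_approx F x d -> co_approx F y e -> `|d - e| <= `|x - y|.
Proof.
move=> sX [Fd dF] [Fe eF].
have [/eqP|u0] := eqVneq (d - e) 0; first by move=> /eqP->; rewrite normr0.
have [f [lf fn fu fd]] := smooth_gateaux sX u0.
(* Nonnegative quotients give a nonnegative derivative of the norm at [d - e]. *)
have pos w : (forall s, 0 < s <= 1 -> 0 <= sqquot s (d - e) w) -> 0 <= f w.
  move=> H; apply/ler_addgt0Pr => k k0; have [r r0 fr] := fd w k k0.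
  pose s := Num.min r 1.
  have s0 : 0 < s by rewrite lt_min r0 ltr01.
  have := H s; rewrite s0 ge_min lexx orbT => /(_ isT).
  rewrite /sqquot ler_pdivlMr// mul0r subr_ge0 ler_sqr ?nnegrE// => H1.
  have := fr s; rewrite s0 ge_min lexx => /(_ isT) H2.
  by rewrite -(pmulr_rge0 _ s0); lra.
have f1 : 0 <= f (x - d) by apply: pos => s; exact: dF.
(* Evenness of the norm turns base point [e - d] and direction [y - e] into [d - e] and
   [- (y - e)]. *)
have f2 : 0 <= f (- (y - e)).
  apply: pos => s s01; have := eF d s Fd s01.
  by rewrite /sqquot -[e - d]opprB -[`|- (d - e) + _|]normrN opprD opprK normrN scalerN.
have : f (d - e) + (f (x - d) + f (- (y - e))) = f (x - y).
  rewrite -!lf.1 opprB; congr f.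
  by rewrite addrC addrACA subrK [e - y - e]addrAC subrr add0r.
by rewrite fu; have := fn (x - y); lra.
Qed.

Lemma compact_existence_retraction F : smooth_space X -> compact F ->
  existence_set F -> contractive F.
Proof.
move=> sX cF eF; split; first by case: eF.
have [P PF] := choice (fun x => co_approx_exists x sX cF eF).
exists P; split; first by move=> x; case: (PF x).
split=> [d Fd|x y]; last exact: co_approx_nonexpansive (PF x) (PF y).
(* A point of [F] solves its own problem, and nonexpansiveness makes the solution unique. *)
have dd : co_approx F d d.
  split=> // c s Fc /andP[s0 _].
  by rewrite /sqquot subrr scaler0 addr0 subrr mul0r.
have := co_approx_nonexpansive sX (PF d) dd.
by rewrite subrr normr0 normr_le0 subr_eq0 => /eqP.
Qed.

End CompactExistenceSet.

(** * Weak limits along ultrafilters and the reflexive case *)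

Section WeakLimits.
Variables (R : realType) (X : normedModType R).
Implicit Types (F : set X) (f : X -> R) (x y z c : X).

(** Continuity at 0 bounds [f] on the unit ball, so the [sup] in [opnorm] is a genuine one. *)
Lemma dual_le_opnorm f y : is_dual f -> `|f y| <= opnorm f * `|y|.
Proof.
move=> [fD [fZ fc]]; have lf : linear_form f by [].
have f0 : f 0 = 0 by rewrite -(scale0r 0) fZ mul0r.
have [d /= d0 fd] : exists2 d : R, 0 < d & forall x, `|x| < d -> `|f x| < 1.
  have /cvgrPdist_lt/(_ 1 ltr01)/nbhs_ballP[d /= d0 fd] := fc 0.
  exists d => // x xd; have := fd x; rewrite -ball_normE/= f0 !sub0r !normrN.
  exact.
have ub : has_ubound [set `|f x| | x in [set x : X | `|x| <= 1]].
  exists (2 / d) => _ [x /= x1 <-].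
  have := fd ((d / 2) *: x); rewrite normrZ gtr0_norm ?divr_gt0//.
  rewrite fZ normrM gtr0_norm ?divr_gt0// => H.
  rewrite ler_pdivlMr//.
  suff /H : d / 2 * `|x| < d by lra.
  by nra.
have [->|y0] := eqVneq y 0; first by rewrite f0 !normr0 mulr0.
have ny0 : 0 < `|y| by rewrite normr_gt0.
rewrite -ler_pdivrMr//.
apply: ub_le_sup => //; exists (`|y|^-1 *: y) => /=.
  by rewrite normrZ normfV normr_id mulVf// lt0r_neq0.
by rewrite fZ normrM normfV normr_id mulrC.
Qed.

Definition weak_limit (I : Type) (U : set_system I) (p : I -> X) z : Prop :=
  forall f, is_dual f -> (fun i => f (p i)) @ U --> f z.

(** The ultrafilter limits of [f (p i)] form a bounded linear functional of [f], which reflexivity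
    represents by a point. *)
Lemma reflexive_weak_limit (I : Type) (U : set_system I) (p : I -> X) (M : R) :
  reflexive_space X -> UltraFilter U -> (\forall i \near U, `|p i| <= M) ->
  exists z, weak_limit U p z.
Proof.
move=> rX UU pM.
have opn0 f : is_dual f -> 0 <= opnorm f.
  (* In the zero space [dual_le_opnorm] says nothing about the sign, so the supremum is treated
     directly. *)
  move=> df; have [[x x0]|H] := pselect (exists x, x != 0).
    have := le_trans (normr_ge0 _) (dual_le_opnorm x df).
    by rewrite pmulr_lge0// normr_gt0.
  rewrite /opnorm; apply: ub_le_sup => /=; last first.
    by exists 0; rewrite /= ?normr0// -(scale0r 0) df.2.1 mul0r normr0.
  exists 0 => _ [x /= _ <-].
  have -> : x = 0 by apply/eqP; apply: contra_notT H => x0; exists x.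
  by rewrite -(scale0r 0) df.2.1 mul0r normr0.
have bnd f : is_dual f -> \forall i \near U, `|f (p i)| <= M * opnorm f.
  move=> df; apply: filterS pM => i pi; rewrite mulrC.
  by apply: le_trans (dual_le_opnorm _ df) _; rewrite ler_wpM2l// opn0.
have cv f : is_dual f -> exists l : R, (fun i => f (p i)) @ U --> l.
  move=> df.
  have [|l _ ?] := compact_ultra_cvg (g := fun i => f (p i)) UU
    (@segment_compact R (- (M * opnorm f)) (M * opnorm f)); last by exists l.
  by apply: filterS (bnd f df) => i; rewrite /= in_itv/= ler_norml.
pose phi f := lim ((fun i => f (p i)) @ U).
have phiE f l : ((fun i => f (p i)) @ U --> l) -> phi f = l by move=> /cvg_lim; exact.
have cvphi f : is_dual f -> (fun i => f (p i)) @ U --> phi f.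
  by move=> /cv[l fl]; rewrite (phiE _ _ fl).
have [|||z zP] := rX phi.
- by move=> f g df dg; apply: phiE; apply: cvgD; exact: cvphi.
- by move=> a f df; apply: phiE; apply: cvgMr; exact: cvphi.
- exists M => f df; apply: (cvgr_to_le (cvg_norm (cvphi f df))); exact: bnd.
by exists z => f df; rewrite -zP//; exact: cvphi.
Qed.

(** Test the weak limit on a support functional of [z]. *)
Lemma weak_limit_norm_le (I : Type) (U : set_system I) (p : I -> X) z (M : R) :
  ProperFilter U -> weak_limit U p z -> (\forall i \near U, `|p i| <= M) ->
  `|z| <= M.
Proof.
move=> UU pz pM; have [f [lf fn fz _]] := norm_subgradient z 0.
rewrite -fz; apply: (cvgr_to_le (pz f (linear_form_dual lf fn))).
by apply: filterS pM => i; apply: le_trans.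
Qed.

(** Mazur's theorem through the distance [g] to [F]: a subgradient [f] at [z] satisfies
    [f (p i) <= f z - g z], and the limit gives [g z <= 0]. *)
Lemma weak_limit_closed_convex (I : Type) (U : set_system I) (p : I -> X) z F :
  ProperFilter U -> weak_limit U p z -> closed F -> convex_set F ->
  (\forall i \near U, F (p i)) -> F z.
Proof.
move=> UU pz clF cvF pF; have [i0 Fi0] := filter_ex pF.
pose J := {c | F c}; pose h (c : J) y := `|y - sval c|.
pose g := inf_fun h.
have gle c y : F c -> g y <= `|y - c|.
  by move=> Fc; apply: (@inf_fun_le _ _ _ h y 0 (exist _ c Fc)) => j; exact: normr_ge0.
have gnear y e : 0 < e -> exists2 c, F c & `|y - c| < g y + e.
  move=> e0; apply: contrapT => H.
  suff : g y + e <= g y by rewrite gerDl leNgt e0.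
  apply: (inf_fun_ge (exist _ _ Fi0)) => -[c Fc].
  by rewrite leNgt; apply/negP => hc; apply: H; exists c.
have gC (t : R) x y : 0 <= t <= 1 ->
    g (t *: x + (1 - t) *: y) <= t * g x + (1 - t) * g y.
  move=> /andP[t0 t1]; apply/ler_addgt0Pr => e e0.
  have [c Fc xc] := gnear x e e0; have [c' Fc' yc'] := gnear y e e0.
  have Fcc : F (t *: c + (1 - t) *: c').
    have := cvF c c' (Itv01 t0 t1); rewrite !inE; exact.
  apply: (le_trans (gle _ _ Fcc)).
  rewrite opprD addrACA -!scalerBr; apply: le_trans (ler_normD _ _) _.
  rewrite !normrZ !ger0_norm ?subr_ge0//.
  have : t * `|x - c| <= t * (g x + e) by rewrite ler_wpM2l// ltW.
  have : (1 - t) * `|y - c'| <= (1 - t) * (g y + e).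
    by rewrite ler_wpM2l ?subr_ge0// ltW.
  by lra.
have gL x y : g x - g y <= `|x - y|.
  rewrite lerBlDr -lerBlDl; apply: (inf_fun_ge (exist _ _ Fi0)) => -[c Fc].
  rewrite lerBlDl; apply: le_trans (gle _ _ Fc) _.
  by rewrite /h/=; exact: ler_distD.
have [f [lf fn fg _]] := subgradient z 0 gC gL.
have gz0 : g z <= 0.
  suff : f z <= f z - g z by lra.
  apply: (cvgr_to_le (pz f (linear_form_dual lf fn))).
  apply: filterS pF => i Fi; have := fg (p i - z).
  rewrite [z + _]addrC subrK linear_formB//.
  by have := gle _ (p i) Fi; rewrite subrr normr0; lra.
apply: clF => B /nbhs_ballP[e /= e0 eB].
have [c Fc zc] := gnear z e e0; exists c; split=> //; apply: eB.
by rewrite -ball_normE/=; lra.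
Qed.

Lemma reflexive_chain_contractive (T : Type) (Ft : T -> set X) F :
  reflexive_space X -> convex_set F -> F !=set0 ->
  (forall t, contractive (Ft t)) ->
  (forall s t, Ft s `<=` Ft t \/ Ft t `<=` Ft s) ->
  F = closure (\bigcup_(t in [set: T]) Ft t) ->
  contractive F.
Proof.
move=> rX cvF F0 cFt tot FE; split=> //.
have FtF t : Ft t `<=` F by rewrite FE => x Fx; apply: subset_closure; exists t.
have [t0 _] : exists t0 : T, True.
  move: F0 => [x]; rewrite FE => /(_ setT filterT)[y [[t _ _] _]]; by exists t.
(* The ultrafilter contains all these tails, so each point of the union is eventually fixed by
   [P s]. *)
pose above t := [set s | Ft t `<=` Ft s].
have [U [UU sU]] : exists U, UltraFilter U /\ filter_from setT above `<=` U.
  apply: ultraFilterLemma; apply: filter_from_proper.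
    apply: filter_fromT_filter; first by exists t0.
    move=> s t; have [st|ts] := tot s t; [exists t|exists s] => r /= H.
      by split=> //; exact: subset_trans H.
    by split=> //; exact: subset_trans H.
  by move=> t _; exists t.
have aboveU t : U (above t) by apply: sU; exists t.
have [P PP] := choice (fun t => (cFt t).2).
have PF t x : F (P t x) by apply: (FtF t); case: (PP t).
have Pid t c : Ft t c -> \forall s \near U, P s c = c.
  by move=> Fc; apply: filterS (aboveU t) => s ts; case: (PP s) => _ [+ _]; apply; exact: ts.
have [c0 Fc0] := (cFt t0).1.
have lim x : exists z, weak_limit U (P ^~ x) z.
  (* The bound comes from [c0], eventually fixed, and nonexpansiveness. *)
  apply: (@reflexive_weak_limit _ _ _ (`|x - c0| + `|c0|)) => //.
  apply: filterS (Pid _ _ Fc0) => s Psc.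
  rewrite -[P s x](subrK c0); apply: le_trans (ler_normD _ _) _.
  by rewrite lerD2r -{1}Psc; case: (PP s) => _ [_]; apply.
have [Q QP] := choice lim.
have QF x : F (Q x).
  apply: (weak_limit_closed_convex _ (QP x)) => //.
    by rewrite FE; exact: closed_closure.
  exact: nearW.
have QL x y : `|Q x - Q y| <= `|x - y|.
  apply: (@weak_limit_norm_le _ U (fun s => P s x - P s y)).
    move=> f df; have lf : linear_form f by case: df => ? [].
    rewrite linear_formB//; under eq_fun do rewrite linear_formB//.
    by apply: cvgB; exact: QP.
  by apply: nearW => s; case: (PP s) => _ [_]; apply.
have Qid t c : Ft t c -> Q c = c.
  move=> Fc; apply/eqP; rewrite -subr_eq0 -normr_le0.
  apply: (@weak_limit_norm_le _ U (fun s => P s c - c)).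
    move=> f df; have lf : linear_form f by case: df => ? [].
    rewrite linear_formB//; under eq_fun do rewrite linear_formB//.
    by apply: cvgB; [exact: QP | exact: cvg_cst].
  by apply: filterS (Pid _ _ Fc) => s ->; rewrite subrr normr0.
exists Q; split=> //; split=> // c Fc.
(* Density: a point [d] of the union within [e / 2] of [c] is fixed by [Q]. *)
apply/eqP; rewrite -subr_eq0 -normr_le0; apply/ler_addgt0Pr => e e0; rewrite add0r.
have e20 : 0 < e / 2 by rewrite divr_gt0.
move: Fc; rewrite FE => /(_ _ (nbhsx_ballx c _ e20))[d [[t _ Fd]]].
rewrite -ball_normE/= => cd.
rewrite -[Q c - c](subrK (Q d - c)).
have -> : Q c - c - (Q d - c) = Q c - Q d by rewrite opprB addrA subrK.
apply: le_trans (ler_normD _ _) _; rewrite (Qid t d Fd).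
have := QL c d; rewrite (Qid t d Fd) [`|d - c|]distrC; lra.
Qed.

End WeakLimits.

Theorem theorem33 (R : realType) :
  (forall (X : completeNormedModType R) (F : set X) (T : Type) (Ft : T -> set X),
      reflexive_space X -> smooth_space X ->
      convex_set F -> existence_set F ->
      (forall t, convex_set (Ft t) /\ compact (Ft t) /\ existence_set (Ft t)) ->
      (forall s t, Ft s `<=` Ft t \/ Ft t `<=` Ft s) ->
      F = closure (\bigcup_(t in [set: T]) Ft t) ->
      contractive F) /\
  (forall (X : completeNormedModType R) (F : set X),
      smooth_space X ->
      convex_set F -> compact F -> existence_set F ->
      contractive F).
Proof.
split=> [X F T Ft rX sX cvF [F0 _] cFt tot FE|X F sX _ cF eF]; last first.
  exact: compact_existence_retraction.
apply: (reflexive_chain_contractive rX cvF F0 _ tot FE) => t.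
by have [_ [? ?]] := cFt t; exact: compact_existence_retraction.
Qed.
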